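(* Let $n\ge2$, let $(\mathcal{A},\{\cdot,\dots,\cdot\},\alpha)$ be an $n$-Hom-pre-Lie superalgebra and let $P:\mathcal{A}\to\mathcal{A}$ be a Rota-Baxter operator of weight zero on it. Then $(\mathcal{A},\{\cdot,\dots,\cdot\}_P,\alpha)$ is an $n$-Hom-pre-Lie superalgebra, where $$\{x_1,\dots,x_n\}_P=\sum_{i=1}^n\{P(x_1),\dots,P(x_{i-1}),x_i,P(x_{i+1}),\dots,P(x_n)\}.$$
   Context: Conventions. $\mathbb{K}$ is an algebraically closed field of characteristic $0$; all vector spaces are over $\mathbb{K}$ and $\mathbb{Z}_2$-graded. $|x|$ is the degree of a homogeneous element; formulas involving degrees are for homogeneous elements. For a tuple $X=(x_1,x_2,\dots)$ put $|X|_i^j=\sum_{k=i}^j|x_k|$ (zero if $j<i$), similarly for $Y$. A hat means omission. A (multi)linear map is even if it preserves degree. Super-skew-symmetric in some consecutive arguments: exchanging adjacent $x_i,x_{i+1}$ among them multiplies the value by $-(-1)^{|x_i||x_{i+1}|}$. $n$-Hom-pre-Lie superalgebra: $(\mathcal{A},\{\cdot,\dots,\cdot\},\alpha)$ with $\{\cdot,\dots,\cdot\}$ even $n$-linear, super-skew-symmetric in the first $n-1$ arguments, $\alpha$ even linear, such that $$\{\alpha(x_1),\dots,\alpha(x_{n-1}),\{y_1,\dots,y_n\}\}=\sum_{i=1}^{n-1}(-1)^{|X|_1^{n-1}|Y|_1^{i-1}}\{\alpha(y_1),\dots,[x_1,\dots,x_{n-1},y_i]^C,\dots,\alpha(y_n)\}+(-1)^{|X|_1^{n-1}|Y|_1^{n-1}}\{\alpha(y_1),\dots,\alpha(y_{n-1}),\{x_1,\dots,x_{n-1},y_n\}\},$$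 $$\{[x_1,\dots,x_n]^C,\alpha(y_1),\dots,\alpha(y_{n-1})\}=\sum_{i=1}^n(-1)^{n-i}(-1)^{|x_i||X|_{i+1}^n}\{\alpha(x_1),\dots,\widehat{\alpha(x_i)},\dots,\alpha(x_n),\{x_i,y_1,\dots,y_{n-1}\}\},$$ where $[x_1,\dots,x_n]^C=\sum_{i=1}^n(-1)^{n-i}(-1)^{|x_i||X|_{i+1}^n}\{x_1,\dots,\widehat{x_i},\dots,x_n,x_i\}$. Rota-Baxter operator of weight zero on $(\mathcal{A},\{\cdot,\dots,\cdot\},\alpha)$: an even linear map $P:\mathcal{A}\to\mathcal{A}$ with $\alpha\circ P=P\circ\alpha$ and $\{P(x_1),\dots,P(x_n)\}=P\big(\sum_{i=1}^n\{P(x_1),\dots,P(x_{i-1}),x_i,P(x_{i+1}),\dots,P(x_n)\}\big)$. *)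

(* Defs.v *)
From HB Require Import structures.
From mathcomp Require Import all_boot all_order all_fingroup all_algebra.

Set Implicit Arguments.
Unset Strict Implicit.
Unset Printing Implicit Defensive.

Import GRing.Theory.
Local Open Scope ring_scope.

(* A tuple (x_1, ..., x_n) is a finite function on 'I_n, so x_i is
   x evaluated at the ordinal i - 1. *)
Section Tuples.
Variable n : nat.

Definition fcomp (T U : Type) k (f : T -> U) (x : {ffun 'I_k -> T}) :
  {ffun 'I_k -> U} := [ffun i => f (x i)].

(* (x_1, ..., v, ..., x_k), with v in place of x_i *)
Definition upd (T : Type) k (x : {ffun 'I_k -> T}) (i : 'I_k) (v : T) :
  {ffun 'I_k -> T} := [ffun j => if j == i then v else x j].

(* (x_1, ..., hat x_i, ..., x_n) *)
Definition omit (T : Type) (x : {ffun 'I_n -> T}) (i : 'I_n) :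
  {ffun 'I_n.-1 -> T} := [ffun j => x (lift i j)].

(* (x_1, ..., x_(n-1), v); the insub is None exactly at the last index. *)
Definition fsnoc (T : Type) (x : {ffun 'I_n.-1 -> T}) (v : T) :
  {ffun 'I_n -> T} := [ffun j : 'I_n => oapp x v (insub (val j))].

(* (v, y_1, ..., y_(n-1)); for j > 0 the index j.-1 is always < n.-1, so the
   default value of oapp is not used. *)
Definition fcons (T : Type) (v : T) (y : {ffun 'I_n.-1 -> T}) :
  {ffun 'I_n -> T} :=
  [ffun j : 'I_n => if val j == 0%N then v else oapp y v (insub (val j).-1)].

End Tuples.

Record superGrading (K : fieldType) (V : lmodType K) := SuperGrading {
  hpart :> 'Z_2 -> {pred V};
  hpart_submod : forall d, submod_closed (hpart d);
  hpart_span : forall v : V,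
    exists v0 v1 : V, [/\ v0 \in hpart 0, v1 \in hpart 1 & v = v0 + v1];
  hpart_direct : forall v : V, v \in hpart 0 -> v \in hpart 1 -> v = 0
}.

Section NHomPreLie.
Variables (K : fieldType) (V : lmodType K) (gr : superGrading V) (n : nat).
Implicit Types (m : {ffun 'I_n -> V} -> V) (alpha P : {linear V -> V}).

Definition homogeneous k (d : {ffun 'I_k -> 'Z_2}) (x : {ffun 'I_k -> V}) :=
  forall i, x i \in gr (d i).

Definition even_map (f : V -> V) := forall d v, v \in gr d -> f v \in gr d.

Definition nlinear m :=
  forall (x : {ffun 'I_n -> V}) (i : 'I_n) (a : K) (u v : V),
    m (upd x i (a *: u + v)) = a *: m (upd x i u) + m (upd x i v).

Definition even_nmap m :=
  forall d x, homogeneous d x -> m x \in gr (\sum_(i < n) d i).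

Definition ssign (d : 'Z_2) : K := (-1) ^+ (d : nat).

(* With 0-based indices, both i and i + 1 lie among the first n - 1 arguments
   iff i + 1 < n - 1. *)
Definition super_skew m :=
  forall d x (i j : 'I_n), homogeneous d x ->
    val j = i.+1 -> (j < n.-1)%N ->
    m [ffun k => x (tperm i j k)] = - (ssign (d i * d j) *: m x).

(* (-1)^(n-i) (-1)^(|x_i| |X|_(i+1)^n), for the 0-based index i *)
Definition hat_sign (d : {ffun 'I_n -> 'Z_2}) (i : 'I_n) : K :=
  (-1) ^+ (n.-1 - i) * ssign (d i * \sum_(k < n | (i < k)%N) d k).

(* [x_1, ..., x_n]^C for homogeneous x; its formula involves the degrees,
   which are passed as d. *)
Definition commC m (d : {ffun 'I_n -> 'Z_2}) (x : {ffun 'I_n -> V}) : V :=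
  \sum_(i < n) hat_sign d i *: m (fsnoc (omit x i) (x i)).

(* The tuple (y_1, ..., y_n) is written as y = (y_1, ..., y_(n-1)) followed
   by yn. *)
Definition preLie_identity1 m alpha :=
  forall (dx dy : {ffun 'I_n.-1 -> 'Z_2}) (dyn : 'Z_2)
         (x y : {ffun 'I_n.-1 -> V}) (yn : V),
    homogeneous dx x -> homogeneous dy y -> yn \in gr dyn ->
    m (fsnoc (fcomp alpha x) (m (fsnoc y yn))) =
      \sum_(i < n.-1)
        ssign ((\sum_(k < n.-1) dx k) * (\sum_(k < n.-1 | (k < i)%N) dy k)) *:
        m (fsnoc (upd (fcomp alpha y) i
                      (commC m (fsnoc dx (dy i)) (fsnoc x (y i))))
                 (alpha yn))
      + ssign ((\sum_(k < n.-1) dx k) * (\sum_(k < n.-1) dy k)) *: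
        m (fsnoc (fcomp alpha y) (m (fsnoc x yn))).

Definition preLie_identity2 m alpha :=
  forall (dx : {ffun 'I_n -> 'Z_2}) (dy : {ffun 'I_n.-1 -> 'Z_2})
         (x : {ffun 'I_n -> V}) (y : {ffun 'I_n.-1 -> V}),
    homogeneous dx x -> homogeneous dy y ->
    m (fcons (commC m dx x) (fcomp alpha y)) =
      \sum_(i < n)
        hat_sign dx i *:
        m (fsnoc (fcomp alpha (omit x i)) (m (fcons (x i) y))).

Record nHomPreLie_superalgebra m alpha : Prop := NHomPreLieSuperalgebra {
  nhpl_nlinear : nlinear m;
  nhpl_even : even_nmap m;
  nhpl_skew : super_skew m;
  nhpl_alpha_even : even_map alpha;
  nhpl_identity1 : preLie_identity1 m alpha;
  nhpl_identity2 : preLie_identity2 m alpha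
}.

(* {x_1, ..., x_n}_P: the i-th summand applies P to every argument but x_i. *)
Definition bracketP m P (x : {ffun 'I_n -> V}) : V :=
  \sum_(i < n) m (upd (fcomp P x) i (x i)).

Record rota_baxter0 m alpha P : Prop := RotaBaxter0 {
  rb_even : even_map P;
  rb_comm : forall v, alpha (P v) = P (alpha v);
  rb_identity : forall x : {ffun 'I_n -> V},
    m (fcomp P x) = P (\sum_(i < n) m (upd (fcomp P x) i (x i)))
}.

End NHomPreLie.

(* Main.v *)
(** For [t : K] put [f_t v = P v + t v].  Since [m] is multilinear,
    [m (f_t x) = f_t {x}_P + O(t^2)]: the Rota-Baxter identity is exactly what
    makes the constant term [P {x}_P].  The tuples [f_t x] are homogeneous of the
    same degrees as [x], so each axiom of [m] holds on them for every [t];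
    comparing the coefficients of [t] gives the axiom for [{.}_P]. *)

Require Import Defs.
From mathcomp Require Import all_boot all_order all_fingroup all_algebra.
Import GRing.Theory.
Local Open Scope ring_scope.

(** * First-order expansions in a parameter [t] *)

Section Jets.
Set Implicit Arguments.
Unset Strict Implicit.
Context {K : fieldType} {V : lmodType K}.
Implicit Types (c : K -> V) (u v : V).

(** [c t = u + t v + O(t^2)], the remainder being a polynomial in [t] given by
    its list of monomials: [(k, w)] stands for [t^(k+2) w]. *)
Definition jet c u v :=
  exists s : seq (nat * V), forall t,
    c t = u + t *: v + \sum_(p <- s) t ^+ p.1.+2 *: p.2.

Lemma eq_jet c c' u v : c =1 c' -> jet c u v -> jet c' u v.
Proof. by move=> ecc' [s cE]; exists s => t; rewrite -ecc'. Qed.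

Lemma jet_const u : jet (fun=> u) u 0.
Proof. by exists [::] => t; rewrite big_nil scaler0 !addr0. Qed.

Lemma jetD c c' u u' v v' :
  jet c u v -> jet c' u' v' -> jet (fun t => c t + c' t) (u + u') (v + v').
Proof.
move=> [s cE] [s' c'E]; exists (s ++ s') => t.
by rewrite cE c'E big_cat scalerDr /= addrACA [X in X + _ = _]addrACA.
Qed.

Lemma jet_linear (f : {linear V -> V}) c u v :
  jet c u v -> jet (fun t => f (c t)) (f u) (f v).
Proof.
move=> [s cE]; exists [seq (p.1, f p.2) | p <- s] => t.
rewrite cE !linearD linearZ linear_sum big_map; congr (_ + _).
by apply: eq_bigr => p _; rewrite linearZ.
Qed.

Lemma jetZ a c u v : jet c u v -> jet (fun t => a *: c t) (a *: u) (a *: v).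
Proof. exact: (jet_linear ( *:%R a)). Qed.

Lemma jet_sum (I : Type) (r : seq I) (F : I -> K -> V) (G H : I -> V) :
  (forall i, jet (F i) (G i) (H i)) ->
  jet (fun t => \sum_(i <- r) F i t) (\sum_(i <- r) G i) (\sum_(i <- r) H i).
Proof.
move=> FJ; elim: r => [|i r IHr].
  by rewrite !big_nil; apply: eq_jet (jet_const _) => t; rewrite big_nil.
by rewrite !big_cons; apply: eq_jet (jetD (FJ i) IHr) => t; rewrite big_cons.
Qed.

(** Since t (u + t v + ...) = t u + t^2 v + ..., the former linear term becomes the monomial
    [(0, v)] and each old monomial moves up one degree. *)
Lemma jetX c u v : jet c u v -> jet (fun t => t *: c t) 0 u.
Proof.
move=> [s cE]; exists ((0%N, v) :: [seq (p.1.+1, p.2) | p <- s]) => t.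
rewrite cE big_cons big_map add0r !scalerDr scalerA -expr2 -addrA; congr (_ + (_ + _)).
by rewrite scaler_sumr; apply: eq_bigr => p _; rewrite scalerA -exprS.
Qed.

Lemma jetXn k c u v : jet c u v -> jet (fun t => t ^+ k.+2 *: c t) 0 0.
Proof.
move=> cJ; elim: k => [|k IHk].
  by apply: eq_jet (jetX (jetX cJ)) => t; rewrite scalerA -expr2.
by apply: eq_jet (jetX IHk) => t; rewrite scalerA -exprS.
Qed.

(** Replacing [c t] by [c (2 t) - 2^(k+2) c t] kills the monomial [t^(k+2) w];
    it multiplies [v] by [2 - 2^(k+2)], nonzero in characteristic [0]. *)
Lemma jet0_inj (charK : [pchar K] =i pred0) u v : jet (fun=> 0) u v -> v = 0.
Proof.
have /pcharf0P nat_eq0 := charK.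
move=> [s]; move sN: (size s) => N.
elim: N s u v sN => [|N IHN] [|[k w] s] //= u v => [_|[sN]] sE.
  (* With no monomials left, t = 0 gives u = 0 and t = 1 gives u + v = 0. *)
  move: (sE 0) (sE 1); rewrite !big_nil !addr0 scale0r addr0 scale1r => <-.
  by rewrite add0r.
(* The replacement multiplies the coefficient of t^j by [b j], which vanishes at j = k + 2. *)
pose b j : K := 2 ^+ j - 2 ^+ k.+2.
have b1_neq0 : b 1%N != 0.
  (* Here 2 - 2^(k+2) = 2 (1 - 2^(k+1)), and 2^(k+1) - 1 is a positive integer. *)
  rewrite /b expr1 exprS -[X in X - _]mulr1 -mulrBr mulf_neq0 ?nat_eq0 //.
  rewrite -opprB oppr_eq0 -natrX -[1]/1%:R -natrB ?expn_gt0 // nat_eq0.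
  by rewrite subn_eq0 -ltnNge (leq_trans _ (ltn_expl _ _)).
suff: b 1%N *: v = 0 by move/eqP; rewrite scaler_eq0 (negPf b1_neq0) => /eqP.
apply: (IHN [seq (p.1, b p.1.+2 *: p.2) | p <- s] (b 0%N *: u)) => [|t].
  by rewrite size_map.
have := f_equal2 (fun z z' => z - 2 ^+ k.+2 *: z') (sE (2 * t)) (sE t).
rewrite scaler0 subr0 => E; apply: {E}(etrans E).
rewrite !big_cons big_map /= !scalerDr !scaler_sumr exprMn -(scalerA _ _ w).
rewrite !opprD [LHS]addrACA [X in X + _ = _]addrACA.
rewrite [X in _ + X = _]addrACA subrr add0r.
congr (_ + _ + _).
- by rewrite /b expr0 scalerBl scale1r.
- by rewrite /b !scalerA -scalerBl mulrBr expr1 ![t * _]mulrC.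
rewrite -sumrB. apply: eq_bigr => p _.
by rewrite /b !scalerA -scalerBl exprMn mulrBr ![t ^+ _ * _]mulrC.
Qed.

Lemma jet_inj (charK : [pchar K] =i pred0) c u u' v v' :
  jet c u v -> jet c u' v' -> v = v'.
Proof.
move=> cJ cJ'; apply/eqP; rewrite -subr_eq0; apply/eqP.
apply: (jet0_inj charK (u := u - u')); have := jetD cJ (jetZ (-1) cJ').
by rewrite !scaleN1r; apply: eq_jet => t; rewrite scaleN1r subrr.
Qed.

(** * Multilinear maps along curves *)

Section Multilinear.
Context {n : nat} {m : {ffun 'I_n -> V} -> V} (mL : nlinear m).
Implicit Types (x y : {ffun 'I_n -> V}) (i : 'I_n).

Lemma updE x i v j : upd x i v j = if j == i then v else x j.
Proof. exact: ffunE. Qed.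

Lemma nlinearD x i u v : m (upd x i (u + v)) = m (upd x i u) + m (upd x i v).
Proof. by have := mL x i 1 u v; rewrite !scale1r. Qed.

Lemma nlinear0 x i : m (upd x i 0) = 0.
Proof. by apply: (addrI (m (upd x i 0))); rewrite -nlinearD !addr0. Qed.

Lemma nlinearZ x i a u : m (upd x i (a *: u)) = a *: m (upd x i u).
Proof. by have := mL x i a u 0; rewrite nlinear0 !addr0. Qed.

Lemma nlinear_sum x i (I : Type) (r : seq I) (F : I -> V) :
  m (upd x i (\sum_(j <- r) F j)) = \sum_(j <- r) m (upd x i (F j)).
Proof.
exact: (big_morph (fun v => m (upd x i v)) (nlinearD x i) (nlinear0 x i)).
Qed.

(** Leibniz rule: expanding every slot, a term of degree one in [t] takes the linear coefficient
    from exactly one slot. *)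
Lemma jet_nlinear (c : K -> {ffun 'I_n -> V}) x y :
  (forall i, jet (fun t => c t i) (x i) (y i)) ->
  jet (fun t => m (c t)) (m x) (\sum_(i < n) m (upd x i (y i))).
Proof.
(* Induction on [k], where only the slots before [k] may vary with [t]. *)
suff IH k : (k <= n)%N -> forall (c : K -> {ffun 'I_n -> V}) x y,
    (forall i, jet (fun t => c t i) (x i) (y i)) ->
    (forall i, (k <= i)%N -> (forall t, c t i = x i) /\ y i = 0) ->
    jet (fun t => m (c t)) (m x) (\sum_(i < n) m (upd x i (y i))).
  by move=> cJ; apply: (IH n) => // i; rewrite leqNgt ltn_ord.
elim: k => [|k IHk] kn {}c {}x {}y cJ c_const.
  rewrite big1 => [|i _]; last by have [_ ->] := c_const i isT; apply: nlinear0.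
  apply: eq_jet (jet_const _) => t; congr m; apply/ffunP => i.
  by have [-> _] := c_const i isT.
pose i0 := Ordinal kn; have [s sE] := cJ i0.
have slotJ w : jet (fun t => m (upd (c t) i0 w)) (m (upd x i0 w))
    (\sum_(i < n) m (upd (upd x i0 w) i (upd y i0 0 i))).
  apply: (IHk (ltnW kn) (fun t => upd (c t) i0 w)) => i.
    rewrite !updE; case: (eqVneq i i0) => [->|ne_i].
      by apply: eq_jet (jet_const w) => t; rewrite updE eqxx.
    by apply: eq_jet (cJ i) => t; rewrite updE (negPf ne_i).
  move=> k_le_i; case: (eqVneq i i0) => [->|ne_i].
    by split=> [t|] /=; rewrite !updE eqxx.
  have [|xE y0] := c_const i; first by rewrite ltn_neqAle k_le_i andbT eq_sym.
  by split=> [t|] /=; rewrite !updE (negPf ne_i).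
have updK (z : {ffun 'I_n -> V}) : upd z i0 (z i0) = z.
  by apply/ffunP => j; rewrite updE; case: eqP => [->|].
(* By linearity in slot [i0], its three pieces are treated apart: the constant one yields the terms
   i <> i0 of the sum, the linear one the term i0, and the remainder nothing below t^2. *)
have xJ := slotJ (x i0); have yJ := jetX (slotJ (y i0)).
have sJ := jet_sum s (fun p => jetXn p.1 (slotJ p.2)).
have := jetD (jetD xJ yJ) sJ.
rewrite !big1_eq !addr0 updK (bigD1 i0) //= updE eqxx nlinear0 add0r addrC.
have -> : \sum_(i < n | i != i0) m (upd x i (upd y i0 0 i)) =
          \sum_(i < n | i != i0) m (upd x i (y i)).
  by apply: eq_bigr => i ne_i; rewrite updE (negPf ne_i).
rewrite [X in _ -> jet _ _ X](bigD1 i0) //; apply: eq_jet => t.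
rewrite -[in RHS](updK (c t)) sE !nlinearD nlinearZ nlinear_sum.
by congr (_ + _); apply: eq_bigr => p _; rewrite nlinearZ.
Qed.
End Multilinear.
End Jets.

(** * Curves adapted to the Rota-Baxter operator *)

Section RotaBaxter.
Set Implicit Arguments.
Unset Strict Implicit.
Context {K : fieldType} (charK : [pchar K] =i pred0).
Context {V : lmodType K} {gr : superGrading V} {n : nat}.
Context {m : {ffun 'I_n -> V} -> V} {alpha P : {linear V -> V}}.
Hypothesis (mS : nHomPreLie_superalgebra gr m alpha).
Hypothesis (PRB : rota_baxter0 gr m alpha P).

Let mP : {ffun 'I_n -> V} -> V := bracketP m P.
Let f (t : K) (v : V) := P v + t *: v.
(** This says that [c t] agrees with [f t v] up to O(t^2). The operations occurring in the axioms
    preserve the relation, with [m] acting on curves and [mP] on their linear coefficients. *)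
Let jetP (c : K -> V) (v : V) := jet c (P v) v.

Let jetP_inj c c' v v' : c =1 c' -> jetP c v -> jetP c' v' -> v = v'.
Proof. by move=> cc' /(eq_jet cc'); apply: jet_inj. Qed.

Let jetP_f v : jetP (f^~ v) v.
Proof. by exists [::] => t; rewrite big_nil addr0. Qed.

Let jetPZ a c v : jetP c v -> jetP (fun t => a *: c t) (a *: v).
Proof. by rewrite /jetP linearZ; apply: jetZ. Qed.

Let jetPD c c' v v' : jetP c v -> jetP c' v' -> jetP (fun t => c t + c' t) (v + v').
Proof. by rewrite /jetP linearD; apply: jetD. Qed.

Let jetP_sum k (c : 'I_k -> K -> V) (v : 'I_k -> V) :
  (forall i, jetP (c i) (v i)) -> jetP (fun t => \sum_i c i t) (\sum_i v i).
Proof. by rewrite /jetP linear_sum; apply: jet_sum. Qed.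

(** Commutation of [alpha] with [P] gives the constant term the required form P (alpha v). *)
Let jetP_alpha c v : jetP c v -> jetP (fun t => alpha (c t)) (alpha v).
Proof. by rewrite /jetP -(rb_comm PRB); apply: jet_linear. Qed.

Let jetP_tuple k (c : K -> {ffun 'I_k -> V}) (x : {ffun 'I_k -> V}) :=
  forall i, jetP (fun t => c t i) (x i).

(** The Leibniz rule gives constant term m (P x) and linear term {x}_P; the Rota-Baxter identity
    rewrites the former as P {x}_P. *)
Let jetP_m c x : jetP_tuple c x -> jetP (fun t => m (c t)) (mP x).
Proof.
move=> cJ; rewrite /jetP -(rb_identity PRB).
apply: (jet_nlinear (nhpl_nlinear mS) (x := fcomp P x)) => i.
by rewrite ffunE; apply: cJ.
Qed.

Let jetP_fcomp k (x : {ffun 'I_k -> V}) : jetP_tuple (fun t => fcomp (f t) x) x.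
Proof. by move=> i; apply: eq_jet (jetP_f _) => t; rewrite ffunE. Qed.

Let jetP_fcomp_alpha k c (x : {ffun 'I_k -> V}) :
  jetP_tuple c x -> jetP_tuple (fun t => fcomp alpha (c t)) (fcomp alpha x).
Proof.
move=> cJ i; rewrite ffunE.
by apply: eq_jet (jetP_alpha (cJ i)) => t; rewrite ffunE.
Qed.

Let jetP_upd k c (x : {ffun 'I_k -> V}) i c' v :
  jetP_tuple c x -> jetP c' v -> jetP_tuple (fun t => upd (c t) i (c' t)) (upd x i v).
Proof.
move=> cJ c'J j; rewrite ffunE; case: (eqVneq j i) => [->|ne_j].
  by apply: eq_jet c'J => t; rewrite ffunE eqxx.
by apply: eq_jet (cJ j) => t; rewrite ffunE (negPf ne_j).
Qed.

Let jetP_omit c (x : {ffun 'I_n -> V}) i :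
  jetP_tuple c x -> jetP_tuple (fun t => omit (c t) i) (omit x i).
Proof. by move=> cJ j; rewrite ffunE; apply: eq_jet (cJ _) => t; rewrite ffunE. Qed.

Let jetP_fsnoc c (x : {ffun 'I_n.-1 -> V}) c' v :
  jetP_tuple c x -> jetP c' v ->
  jetP_tuple (fun t => fsnoc (c t) (c' t) : {ffun 'I_n -> V}) (fsnoc x v).
Proof.
move=> cJ c'J j; rewrite ffunE; case E: insub => [i|] /=.
  by apply: eq_jet (cJ i) => t; rewrite ffunE E.
by apply: eq_jet c'J => t; rewrite ffunE E.
Qed.

Let jetP_fcons c (x : {ffun 'I_n.-1 -> V}) c' v :
  jetP_tuple c x -> jetP c' v ->
  jetP_tuple (fun t => fcons (c' t) (c t) : {ffun 'I_n -> V}) (fcons v x).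
Proof.
move=> cJ c'J j; rewrite ffunE; case j0: (val j == 0%N).
  by apply: eq_jet c'J => t; rewrite ffunE j0.
case E: insub => [i|] /=.
  by apply: eq_jet (cJ i) => t; rewrite ffunE j0 E.
(* The default value in [fcons] is again its head, so the same curve serves. *)
by apply: eq_jet c'J => t; rewrite ffunE j0 E.
Qed.

(** The signs depend on [d] alone, so they are scalars constant in [t]. *)
Let jetP_commC d c x :
  jetP_tuple c x -> jetP (fun t => commC m d (c t)) (commC mP d x).
Proof.
move=> cJ; apply: jetP_sum => i; apply/jetPZ/jetP_m/jetP_fsnoc => //.
exact: jetP_omit.
Qed.

(** * Gradings, and the axioms for the new bracket *)

Let homogeneousD d u v : u \in gr d -> v \in gr d -> u + v \in gr d.
Proof. by have [_ grD] := hpart_submod gr d; move=> du dv; rewrite -[u]scale1r grD. Qed.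

Let f_even t : even_map gr (f t).
Proof.
move=> d v dv; rewrite /f addrC; have [_ grD] := hpart_submod gr d.
by rewrite grD // (rb_even PRB).
Qed.

Let f_homogeneous t k (d : {ffun 'I_k -> 'Z_2}) x :
  homogeneous gr d x -> homogeneous gr d (fcomp (f t) x).
Proof. by move=> dx i; rewrite ffunE; apply: f_even. Qed.

Let bracketP_nlinear : nlinear mP.
Proof.
move=> x i a u v.
pose c t w := m (upd (fcomp (f t) x) i w).
have cJ c' w : jetP c' w -> jetP (fun t => c t (c' t)) (mP (upd x i w)).
  by move=> c'J; apply/jetP_m/jetP_upd.
apply: jetP_inj (cJ _ _ (jetPD (jetPZ a (jetP_f u)) (jetP_f v)))
  (jetPD (jetPZ a (cJ _ _ (jetP_f u))) (cJ _ _ (jetP_f v))) => t.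
exact: (nhpl_nlinear mS).
Qed.

(** Membership in a graded part is not an equation to be compared in [t], so it is checked directly:
    [P] is even, hence each summand of {x}_P has the right degree. *)
Let bracketP_even : even_nmap gr mP.
Proof.
move=> d x dx; have [gr0 _] := hpart_submod gr (\sum_i d i).
apply: (big_ind (fun v => v \in gr (\sum_i d i))) => // [u v|i _].
  exact: homogeneousD.
apply: (nhpl_even mS) => j; rewrite ffunE; case: eqP => [->|_] //.
by rewrite ffunE; apply: (rb_even PRB).
Qed.

Let bracketP_skew : super_skew gr mP.
Proof.
(* The minus sign is written as the scalar -1 so that [jetPZ] covers it. *)
move=> d x i j dx ij jn; rewrite -scaleN1r.
have xJ : jetP (fun t => m [ffun k => fcomp (f t) x (tperm i j k)])
               (mP [ffun k => x (tperm i j k)]).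
  apply: jetP_m => k; rewrite ffunE.
  by apply: eq_jet (jetP_fcomp x _) => t; rewrite !ffunE.
apply: jetP_inj xJ (jetPZ (-1) (jetPZ (ssign K (d i * d j)) (jetP_m (jetP_fcomp x)))) => t.
by rewrite scaleN1r; apply: (nhpl_skew mS) => //; apply: f_homogeneous.
Qed.

(** Both sides are assembled as curves from [f t] applied to the arguments; they coincide for all
    [t] by the identity for [m], and their linear coefficients are the two sides for [mP]. *)
Let bracketP_identity1 : preLie_identity1 gr mP alpha.
Proof.
move=> dx dy dyn x y yn dxP dyP dynP.
have xJ := jetP_fcomp x; have yJ := jetP_fcomp y; have ynJ := jetP_f yn.
have axJ := jetP_fcomp_alpha xJ; have ayJ := jetP_fcomp_alpha yJ.
have lhsJ := jetP_m (jetP_fsnoc axJ (jetP_m (jetP_fsnoc yJ ynJ))).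
have sumJ := jetP_sum (fun i => jetPZ
  (ssign K ((\sum_(k < n.-1) dx k) * (\sum_(k < n.-1 | (k < i)%N) dy k)))
  (jetP_m (jetP_fsnoc
    (jetP_upd i ayJ (jetP_commC (fsnoc dx (dy i)) (jetP_fsnoc xJ (yJ i))))
    (jetP_alpha ynJ)))).
have lastJ := jetPZ (ssign K ((\sum_(k < n.-1) dx k) * (\sum_(k < n.-1) dy k)))
  (jetP_m (jetP_fsnoc ayJ (jetP_m (jetP_fsnoc xJ ynJ)))).
apply: jetP_inj lhsJ (jetPD sumJ lastJ) => t.
exact: (nhpl_identity1 mS (f_homogeneous t dxP) (f_homogeneous t dyP)
                          (f_even t dynP)).
Qed.

Let bracketP_identity2 : preLie_identity2 gr mP alpha.
Proof.
move=> dx dy x y dxP dyP.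
have xJ := jetP_fcomp x; have yJ := jetP_fcomp y.
have lhsJ := jetP_m (jetP_fcons (jetP_fcomp_alpha yJ) (jetP_commC dx xJ)).
have rhsJ := jetP_sum (fun i => jetPZ (hat_sign K dx i)
  (jetP_m (jetP_fsnoc (jetP_fcomp_alpha (jetP_omit i xJ))
                      (jetP_m (jetP_fcons yJ (xJ i)))))).
apply: jetP_inj lhsJ rhsJ => t.
by apply: (nhpl_identity2 mS); apply: f_homogeneous.
Qed.

Lemma bracketP_superalgebra : nHomPreLie_superalgebra gr (bracketP m P) alpha.
Proof. by split=> //; apply: (nhpl_alpha_even mS). Qed.

End RotaBaxter.

Theorem proposition3p16 (K : closedFieldType) (charK : [pchar K] =i pred0)
  (V : lmodType K) (gr : superGrading V) (n : nat) (n_ge2 : (2 <= n)%N)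
  (m : {ffun 'I_n -> V} -> V) (alpha P : {linear V -> V}) :
  nHomPreLie_superalgebra gr m alpha ->
  rota_baxter0 gr m alpha P ->
  nHomPreLie_superalgebra gr (bracketP m P) alpha.
Proof. exact: bracketP_superalgebra. Qed.
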